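(* Let $G$ be a finite connected simple cubic graph that admits a minimal chordal sense of direction and is not isomorphic to $K_4$. Then $G$ has a $6$-cycle double cover.
   Context: All graphs are finite, connected, undirected, with no multiple edges or self-loops. A cubic graph is a $3$-regular graph. A cycle double cover (CDC) of a graph $G$ is a collection of cycles of $G$ such that every edge of $G$ belongs to exactly two of the cycles in the collection. A $6$-cycle double cover ($6$-CDC) is a CDC in which every cycle has length $6$. A chordal sense of direction on a graph $G$ with $n$ vertices is an edge labeling, assigning to each edge two labels (one for each of its end vertices), obtained as follows: fix a cyclic ordering of the vertices of $G$ (i.e. a bijection $r$ from $V(G)$ to $\mathbb{Z}_n$), and for each edge $uv$ let the label of $uv$ corresponding to $u$ be the rank difference from $u$ to $v$ modulo $n$, i.e. $r(v)-r(u) \bmod n$, and let the label of $uv$ corresponding to $v$ be $r(u)-r(v) \bmod n$. A chordal sense of direction is minimal if the total number of distinct labels used over the whole graph is exactly $\Delta(G)$, the maximum degree of $G$ (so exactly $3$ for a cubic graph). $G$ admits a minimal chordal sense of direction (MCSD) if some choice of cyclic ordering yields a minimal one. *)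

(* Defs.v *)
From HB Require Import structures.
From mathcomp Require Import all_boot all_order all_algebra.

Set Implicit Arguments.
Unset Strict Implicit.
Unset Printing Implicit Defensive.

Record sgraph := SGraph {
  vertex :> finType;
  adj : rel vertex;
  adj_sym : symmetric adj;
  adj_irrefl : irreflexive adj }.

Definition connected_graph (G : sgraph) : Prop :=
  0 < #|G| /\ forall x y : G, connect (@adj G) x y.

Definition degree (G : sgraph) (x : G) : nat := #|[set y | adj x y]|.

Definition max_degree (G : sgraph) : nat := \max_(x : G) degree x.

Definition cubic (G : sgraph) : Prop := forall x : G, degree x = 3.

Definition isomorphic (G H : sgraph) : Prop :=
  exists2 f : G -> H, bijective f & forall x y, adj (f x) (f y) = adj x y.

Lemma neq_sym (T : eqType) : symmetric (fun x y : T => x != y).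
Proof. by move=> x y; rewrite eq_sym. Qed.

Lemma neq_irrefl (T : eqType) : irreflexive (fun x y : T => x != y).
Proof. by move=> x; rewrite eqxx. Qed.

Definition complete_graph (n : nat) : sgraph :=
  SGraph (@neq_sym 'I_n) (@neq_irrefl 'I_n).

(* A cycle is given by the sequence of its vertices in cyclic order, without  *)
(* repeating the first one; the bound on the size rules out the empty cycle,  *)
(* single vertices and the sequence x, y of the ends of one edge.             *)
Definition is_cycle (G : sgraph) (c : seq G) : bool :=
  (2 < size c) && ucycleb (@adj G) c.

Definition on_cycle (G : sgraph) (c : seq G) (x y : G) : bool :=
  ((x \in c) && (next c x == y)) || ((y \in c) && (next c y == x)).

(* A list of cycles, so that a cycle may be used twice, as usual for cycle    *)
(* double covers.                                                             *)
Definition cycle_double_cover (G : sgraph) (C : seq (seq G)) : Prop :=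
  all (@is_cycle G) C /\
  forall x y : G, adj x y -> count (fun c => on_cycle c x y) C = 2.

Definition has_6CDC (G : sgraph) : Prop :=
  exists2 C : seq (seq G),
    cycle_double_cover C & all (fun c => size c == 6) C.

(* The label of the edge uv at its end u, for the cyclic ordering r of the    *)
(* vertices. Residues mod #|G| are represented by integers in [0, #|G|)       *)
(* because 'Z_n is not Z/n for n < 2.                                         *)
Definition chordal_label (G : sgraph) (r : G -> 'I_#|G|) (u v : G) : int :=
  (((r v)%:Z - (r u)%:Z) %% #|G|%:Z)%Z.

(* Ranging over ordered pairs of adjacent vertices collects both labels of    *)
(* every edge.                                                                *)
Definition labels (G : sgraph) (r : G -> 'I_#|G|) : seq int :=
  undup [seq chordal_label r uv.1 uv.2 | uv in [pred p : G * G | adj p.1 p.2]].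

Definition admits_MCSD (G : sgraph) : Prop :=
  exists2 r : G -> 'I_#|G|, bijective r & size (labels r) = max_degree G.

(* Main.v *)
(* An MCSD makes [G] a circulant graph on Z/n whose connection set has three   *)
(* elements; being closed under opposite, it is {h, k, -k} with 2h = 0. The    *)
(* hexagons x, x+k, x+2k, x+2k+h, x+k+h, x+h, one for each class of x modulo   *)
(* h, form a 6-CDC: the edge y, y+k lies on those of y and y-k, and the edge   *)
(* y, y+h on those of y and y-2k. These are genuine, distinct hexagons unless  *)
(* 2k = h, in which case connectedness forces n = 4, that is, G = K_4.         *)

Require Import Defs.
From mathcomp Require Import all_boot all_order all_algebra.
From mathcomp Require Import zify.

Set Implicit Arguments.
Unset Strict Implicit.
Unset Printing Implicit Defensive.

Import GRing.Theory.

(** The three neighbours of a vertex have distinct rank differences, so if only three labels occur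
    in all, each vertex uses every one of them. Adjacency then means that the difference lies in a
    fixed set [S], which is how [theorem10] reaches [circulant_6CDC]. There [symmetric3E] splits [S]
    into an element [h] of order two and a pair [k], [- k], and [isomorphic_K4] rules out
    [k + k = h]. The translations by [k] and [h] then satisfy the hypotheses of [hexagon_6CDC],
    where double covering becomes a count of two orbits of [t] ([count_half]). *)

Lemma on_cycleC (G : sgraph) (c : seq G) (x y : G) :
  on_cycle c x y = on_cycle c y x.
Proof. by rewrite /on_cycle orbC. Qed.

Lemma next6E (T : eqType) (a b c d e f x y : T) :
  uniq [:: a; b; c; d; e; f] ->
  (x \in [:: a; b; c; d; e; f]) && (next [:: a; b; c; d; e; f] x == y) =
  ((x, y) \in [:: (a, b); (b, c); (c, d); (d, e); (e, f); (f, a)]).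
Proof.
move=> abcdef_uniq; rewrite !inE !xpair_eqE ![y == _]eq_sym /=.
case xa: (x == a); case xb: (x == b); case xc: (x == c);
  case xd: (x == d); case xe: (x == e); case xf: (x == f);
  rewrite ?orbF //; exfalso; move: abcdef_uniq;
  do ?[rewrite -(eqP xa)]; do ?[rewrite -(eqP xb)]; do ?[rewrite -(eqP xc)];
  do ?[rewrite -(eqP xd)]; do ?[rewrite -(eqP xe)]; do ?[rewrite -(eqP xf)];
  by rewrite /= !inE ?eqxx /= ?orbT /= ?andbF.
Qed.

(** * Hexagons spanned by two commuting translations *)

Section HexagonCover.

Variables (G : sgraph) (s t : G -> G).
Hypothesis adjE : forall x y, adj x y = [|| y == t x, y == s x | x == s y].
Hypothesis s_inj : injective s.
Hypothesis tK : involutive t.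
Hypothesis stC : forall x, t (s x) = s (t x).
Hypothesis t_neq : forall x, t x != x.
Hypothesis s_neq : forall x, s x != x.
Hypothesis s_neqt : forall x, s x != t x.
Hypothesis ss_neq : forall x, s (s x) != x.
Hypothesis ss_neqt : forall x, s (s x) != t x.

Let t_inj : injective t := can_inj tK.

(** Both orientations are listed so that rewriting with [stE] can settle comparisons between hexagon
    vertices. *)
Let step_neq x : ((t x == x) = false) * ((x == t x) = false) *
  ((s x == x) = false) * ((x == s x) = false) *
  ((s x == t x) = false) * ((t x == s x) = false) *
  ((s (s x) == x) = false) * ((x == s (s x)) = false) *
  ((s (s x) == t x) = false) * ((t x == s (s x)) = false) *
  ((s (t x) == x) = false) * ((x == s (t x)) = false) *
  ((s (s (t x)) == x) = false) * ((x == s (s (t x))) = false).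
Proof.
have neqs (y z : G) : y != z -> ((y == z) = false) * ((z == y) = false).
  by move=> /negbTE yz; rewrite [z == y]eq_sym yz.
have st_neq : s (t x) != x by rewrite -(inj_eq t_inj) stC tK.
have sst_neq : s (s (t x)) != x by rewrite -(inj_eq t_inj) !stC tK.
by rewrite !(neqs _ _ (t_neq x), neqs _ _ (s_neq x), neqs _ _ (s_neqt x),
  neqs _ _ (ss_neq x), neqs _ _ (ss_neqt x), neqs _ _ st_neq,
  neqs _ _ sst_neq).
Qed.

Let stE := (stC, tK, inj_eq s_inj, inj_eq t_inj, step_neq, eqxx).

(* [s] and [t] stand for the translations by k and h. *)
Definition hexagon x := [:: x; s x; s (s x); s (s (t x)); s (t x); t x].

Lemma hexagon_uniq x : uniq (hexagon x).
Proof. by rewrite /= !inE !stE. Qed.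

Lemma hexagon_cycle x : is_cycle (hexagon x).
Proof.
by rewrite /is_cycle /ucycleb hexagon_uniq /= !adjE !stE ?orbT.
Qed.

Lemma on_hexagonE x u v :
  on_cycle (hexagon x) u v =
  let E := [:: (x, s x); (s x, s (s x)); (s (s x), s (s (t x)));
    (s (s (t x)), s (t x)); (s (t x), t x); (t x, x)] in
  ((u, v) \in E) || ((v, u) \in E).
Proof. by rewrite /on_cycle !next6E ?hexagon_uniq. Qed.

(** The hexagon bounds a ladder whose sides are the paths along [s] from [x] and from [t x].
    Reversed matches fail by [ss_neq], matches with a rung by [s_neqt]. *)
Lemma on_hexagon_s x y :
  on_cycle (hexagon x) y (s y) = (y \in [:: x; t x; s x; t (s x)]).
Proof.
rewrite on_hexagonE /= !inE !xpair_eqE; apply/idP/idP => [H|]; last first.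
  by case/or4P=> /eqP ->; rewrite ?stE ?orbT.
repeat (case/orP: H => H).
all: try (case/andP: H => /eqP ->; by rewrite ?stE ?orbT).
all: case/andP: H => /[swap] /eqP ->; by rewrite ?stE ?orbT.
Qed.

(** Only the end rungs, at [x] and [s (s x)], belong to the hexagon; the middle one, at [s x], is a
    chord. *)
Lemma on_hexagon_t x y :
  on_cycle (hexagon x) y (t y) = (y \in [:: x; t x; s (s x); t (s (s x))]).
Proof.
rewrite on_hexagonE /= !inE !xpair_eqE; apply/idP/idP => [H|]; last first.
  by case/or4P=> /eqP ->; rewrite ?stE ?orbT.
repeat (case/orP: H => H).
all: try (case/andP: H => /eqP ->; by rewrite ?stE ?orbT).
all: case/andP: H => /[swap] /eqP ->; by rewrite ?stE ?orbT.
Qed.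

(* Every orbit of [t] meets [half] in exactly one vertex. *)
Definition half : pred G := fun x => enum_rank x < enum_rank (t x).

Lemma half_t x : half (t x) = ~~ half x.
Proof.
rewrite /half tK -leqNgt [RHS]leq_eqVlt.
by rewrite (inj_eq (@ord_inj _)) (inj_eq enum_rank_inj) !stE.
Qed.

(** With [h] the inverse of [g], the candidates [x] form the orbits of [y] and [h y] under [t].
    These are distinct by the last two hypotheses, and [half] keeps one vertex of each. Edges along
    [s] need [g] to be [s]; edges along [t] need its square. *)
Lemma count_half (g : G -> G) (y : G) :
  injective g -> (forall x, t (g x) = g (t x)) ->
  (forall x, g x != x) -> (forall x, g x != t x) ->
  count (fun x => y \in [:: x; t x; g x; t (g x)]) (filter half (enum G)) = 2.
Proof.
move=> g_inj tg g_neq g_neqt.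
have [h hK gK] := injF_bij g_inj.
have th x : t (h x) = h (t x) by rewrite -[LHS]hK -tg gK.
have neq x : (h x == x = false) /\ (h x == t x = false).
  split; apply/negbTE; rewrite -(inj_eq g_inj) gK eq_sym ?g_neq //.
  by rewrite -tg -(inj_eq t_inj) tK g_neqt.
have E : [seq x <- enum G | y \in [:: x; t x; g x; t (g x)]]
    =i [:: y; t y; h y; t (h y)].
  move=> x; rewrite mem_filter mem_enum andbT !inE.
  rewrite [y == x]eq_sym -(inj_eq t_inj y) tK [t y == x]eq_sym.
  rewrite -(inj_eq (can_inj gK) y) hK [h y == x]eq_sym.
  by rewrite -(inj_eq t_inj y) tK -(inj_eq (can_inj gK) (t y)) hK -th
    [t (h y) == x]eq_sym.
have yU : uniq [:: y; t y; h y; t (h y)].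
  have [h1 h2] := neq y.
  have h3 : (t (h y) == y) = false by rewrite -(inj_eq t_inj) tK.
  rewrite /= !inE [y == h y]eq_sym [y == t (h y)]eq_sym [t y == h y]eq_sym.
  by rewrite [t y == t (h y)]eq_sym (inj_eq t_inj) h1 h2 h3 !stE.
have EU := filter_uniq (fun x => y \in [:: x; t x; g x; t (g x)]) (enum_uniq G).
(* Exchange the two conditions, so that [half] is counted over the four explicit candidates. *)
rewrite count_filter (eq_count (fun x => andbC _ _)) -count_filter.
rewrite (seq.permP (uniq_perm EU yU E)) /=.
by rewrite !half_t; do 2 case: half.
Qed.

(** The sequence [hexagon (t x)] is the reverse of [hexagon x], so one hexagon is taken per orbit of
    [t]. *)
Lemma hexagon_6CDC : has_6CDC G.
Proof.
exists [seq hexagon x | x <- enum G & half x]; last first.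
  by apply/allP => c /mapP[x _ ->].
split; first by apply/allP => c /mapP[x _ ->]; apply: hexagon_cycle.
have st x y : (y == s x) || (y == t x) ->
    count (fun c => on_cycle c x y) [seq hexagon x | x <- enum G & half x] = 2.
  rewrite count_map => /orP[]/eqP->.
    under eq_count do rewrite /= on_hexagon_s.
    by apply: count_half.
  under eq_count do rewrite /= on_hexagon_t.
  apply: count_half => //; first exact: inj_comp.
  by move=> z; rewrite /= !stC.
move=> x y; rewrite adjE => /or3P[xy|xy|xy].
- by apply: st; rewrite xy orbT.
- by apply: st; rewrite xy.
by under eq_count do rewrite on_cycleC; apply: st; rewrite xy.
Qed.

End HexagonCover.

(** * Symmetric three-element subsets of Z/n *)

Local Open Scope ring_scope.

(** As a natural number, the double of such an element lies strictly between 0 and twice [m.+1], so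
    it equals [m.+1]. *)
Lemma Zp_2torsion_eq m (a b : 'I_m.+1) :
  a != 0 -> b != 0 -> a + a = 0 -> b + b = 0 -> a = b.
Proof.
have half_eq (c : 'I_m.+1) : c != 0 -> c + c = 0 -> (c + c = m.+1)%N.
  move=> c_neq0 /(congr1 val) /=; have := ltn_ord c.
  have : (0 < c)%N by rewrite lt0n.
  have [cc|cc] := ltnP (c + c) m.+1; first by rewrite modn_small //; lia.
  by rewrite -(subnK cc) modnDr => ? ?; rewrite modn_small; lia.
move=> a0 b0 aa bb; apply/val_inj/double_inj.
by rewrite -!addnn (half_eq a) // (half_eq b).
Qed.

(** Negation, an involution on three elements, fixes one of them, [h]; by [Zp_2torsion_eq] it fixes
    no other, so it exchanges the remaining two. *)
Lemma symmetric3E m (S : {set 'I_m.+1}) :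
  #|S| = 3%N -> 0 \notin S -> (forall d, d \in S -> - d \in S) ->
  exists h k, [/\ S = [set h; k; - k], h + h = 0, h != 0 & k + k != 0].
Proof.
have wlog_case (a b c : 'I_m.+1) : S = [set a; b; c] -> uniq [:: a; b; c] ->
    0 \notin S -> - b \in S -> - a = a ->
    exists h k, [/\ S = [set h; k; - k], h + h = 0, h != 0 & k + k != 0].
  move=> -> abc_uniq S0 bS aN; have aa : a + a = 0 by rewrite -{2}aN subrr.
  have [a0 b0] : a != 0 /\ b != 0.
    by split; apply: contraNneq S0 => <-; rewrite !inE eqxx ?orbT.
  have bb : b + b != 0.
    apply: contraTneq abc_uniq => bb.
    by rewrite (Zp_2torsion_eq a0 b0 aa bb) /= inE eqxx.
  exists a, b; split=> //; congr (_ :|: [set _]).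
  move: bS; rewrite !inE -orbA eqr_oppLR aN.
  case/or3P=> [/eqP ba|/eqP bNb|/eqP-> //].
    by move: abc_uniq; rewrite ba /= inE eqxx.
  by rewrite -{2}bNb subrr eqxx in bb.
move=> S3 S0 SN; have : size (enum S) = 3%N by rewrite -cardE.
have := enum_uniq S; case ES : (enum S) => [|a [|b [|c []]]] // abcU _.
have SE : S = [set a; b; c].
  by apply/setP => x; rewrite -mem_enum ES !inE orbA.
have [aS bS cS] : [/\ - a \in S, - b \in S & - c \in S].
  by split; apply: SN; rewrite SE !inE eqxx ?orbT.
have [aN|aN] := eqVneq (- a) a; first exact: (wlog_case a b c).
have [bN|bN] := eqVneq (- b) b.
  apply: (wlog_case b a c) => //; first by rewrite SE [[set a; b]]setUC.
  by move: abcU; rewrite /= !inE [b == a]eq_sym; do 3 case: (_ == _).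
have [cN|cN] := eqVneq (- c) c.
  apply: (wlog_case c a b) => //; first by rewrite SE setUC setUA.
  by move: abcU; rewrite /= !inE ![c == _]eq_sym; do 3 case: (_ == _).
(* Without a fixed point, [- a] is [b] or [c], and injectivity leaves no value for the opposite of
   the third element. *)
move: abcU; rewrite /= !inE !negb_or andbT => /andP[/andP[ab ac] bc].
move: aS bS cS; rewrite SE !inE (negbTE aN) (negbTE bN) (negbTE cN) /= !orbF.
case/orP=> /eqP aE bS cS.
  case/orP: cS => /eqP cE.
    by rewrite -aE -cE opprK eqxx in bc.
  by rewrite -(inj_eq oppr_inj) aE cE eqxx in ac.
case/orP: bS => /eqP bE.
  by rewrite -aE -bE opprK eqxx in bc.
by rewrite -(inj_eq oppr_inj) aE bE eqxx in ab.
Qed.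

(** * Cubic circulant graphs and the exception *)

Lemma isomorphic_K4 (G : sgraph) :
  (0 < #|G| <= 4)%N -> cubic G -> isomorphic G (complete_graph 4).
Proof.
case/andP=> /card_gt0P[x0 _] G_le4 Gcubic.
(* At most three vertices differ from [x], so its three neighbours are all of them. *)
have nbrs (x : G) : [set y | adj x y] = [set~ x].
  apply/eqP; rewrite eqEcard [#|[set y | _]|]Gcubic cardsC1.
  apply/andP; split; last by case: #|G| G_le4 => //= n.
  by apply/subsetP => y; rewrite !inE; apply: contraTneq => ->;
    rewrite adj_irrefl.
have G4 : #|G| = 4%N.
  by have := Gcubic x0; rewrite /degree nbrs cardsC1; case: #|G| => //= n ->.
exists (cast_ord G4 \o enum_rank) => [|x y].
  apply: inj_card_bij; last by rewrite card_ord G4.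
  by move=> x y /= /cast_ord_inj/enum_rank_inj.
rewrite /= (inj_eq (@cast_ord_inj _ _ G4)) (inj_eq enum_rank_inj).
by have /setP/(_ y) := nbrs x; rewrite !inE eq_sym => ->.
Qed.

Lemma circulant_6CDC (G : sgraph) m (f : G -> 'I_m.+1) (S : {set 'I_m.+1}) :
  bijective f -> (forall x y, adj x y = (f y - f x \in S)) -> #|S| = 3%N ->
  connected_graph G -> cubic G -> ~ isomorphic G (complete_graph 4) ->
  has_6CDC G.
Proof.
case=> g fK gK fS S3 [G_gt0 Gconn] Gcubic GnK4.
have /card_gt0P[x0 _] := G_gt0.
have S0 : 0 \notin S by rewrite -(subrr (f x0)) -fS adj_irrefl.
have SN d : d \in S -> - d \in S.
  move=> dS; have : adj x0 (g (f x0 + d)) by rewrite fS gK addrAC subrr add0r.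
  by rewrite adj_sym fS gK opprD addrA subrr add0r.
have [h [k [SE hh h0 kk]]] := symmetric3E S3 S0 SN.
have [hk k0] : h != k /\ k != 0.
  split; last by apply: contraNneq S0 => <-; rewrite SE !inE eqxx orbT.
  by apply: contraTneq kk => <-; rewrite hh eqxx.
(* Otherwise [S] consists of [k], [k *+ 2] and [k *+ 3], with [k *+ 4 = 0]. The translates of [x0]
   by multiples of [k], at most four, are closed under adjacency and exhaust the connected graph. *)
have kkh : k + k != h.
  apply/eqP => kkh; apply: GnK4; apply: isomorphic_K4 => //; rewrite G_gt0 /=.
  have k4 : k *+ 4 = 0 by rewrite -hh -kkh -!mulr2n -mulrnA.
  have kmod j : k *+ j = k *+ (j %% 4).
    by rewrite [in LHS](divn_eq j 4) mulrnDr mulnC mulrnA k4 mul0rn add0r.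
  pose A := [pred y | [exists i : 'I_4, y == g (f x0 + k *+ i)]].
  have AT y : y \in A.
    have clA : closed (@adj G) A.
      apply: intro_closed; first exact/sym_connect_sym/adj_sym.
      move=> {}y z; rewrite fS => yz /existsP[i /eqP yE].
      have [j jE] : exists j, f z - f y = k *+ j.
        move: yz; rewrite SE !inE -orbA => /or3P[]/eqP->.
        - by exists 2; rewrite mulr2n kkh.
        - by exists 1%N.
        by exists 3; apply/eqP; rewrite eq_sym -addr_eq0 -mulrSr k4.
      apply/existsP; exists (inord ((i + j) %% 4)).
      rewrite inordK ?ltn_mod // -kmod mulrnDr -jE addrA.
      by rewrite -[_ + k *+ i]gK -yE addrC subrK fK.
    rewrite -(closed_connect clA (Gconn x0 y)); apply/existsP; exists ord0.
    by rewrite mulr0n addr0 fK.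
  pose F (i : 'I_4) := g (f x0 + k *+ i).
  rewrite -[4%N]card_ord; apply: leq_trans (leq_image_card F 'I_4).
  apply/subset_leq_card/subsetP => y _; have /existsP[i /eqP ->] := AT y.
  exact: (image_f F).
have f_inj := can_inj fK; have g_inj := can_inj gK.
apply: (@hexagon_6CDC G (fun x => g (f x + k)) (fun x => g (f x + h))).
- move=> x y; rewrite fS SE !inE -orbA -!(inj_eq f_inj) !gK.
  by rewrite !subr_eq ![_ + f x]addrC [f y == f x - k]eq_sym subr_eq.
- by move=> x y /g_inj /addIr /f_inj.
- by move=> x; rewrite gK -addrA hh addr0 fK.
- by move=> x; rewrite !gK addrAC.
- by move=> x; rewrite -(inj_eq f_inj) gK -subr_eq0 addrAC subrr add0r.
- by move=> x; rewrite -(inj_eq f_inj) gK -subr_eq0 addrAC subrr add0r.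
- by move=> x; rewrite (inj_eq g_inj) (inj_eq (addrI _)) eq_sym.
- move=> x; rewrite -(inj_eq f_inj) !gK -subr_eq0.
  by rewrite -[f x + k + k]addrA addrAC subrr add0r.
by move=> x; rewrite (inj_eq g_inj) gK -addrA (inj_eq (addrI _)).
Qed.

(** * From minimal labelings to circulant graphs *)

Lemma max_degree_cubic (G : sgraph) :
  (0 < #|G|)%N -> cubic G -> max_degree G = 3%N.
Proof.
case/card_gt0P=> x _ Gcubic; apply/eqP; rewrite eqn_leq.
rewrite -{2}(Gcubic x) leq_bigmax andbT.
by apply/bigmax_leqP => y _; rewrite Gcubic.
Qed.

(** Subtraction in ['I_m.+1] adds [m.+1 - b]; over the integers the extra [m.+1] vanishes modulo
    itself. *)
Lemma modz_subE m (a b : 'I_m.+1) :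
  ((a%:Z - b%:Z) %% m.+1%:Z)%Z = (a - b : 'I_m.+1)%R%:Z.
Proof.
rewrite /= modnDmr -modz_nat PoszD -subzn ?(ltnW (ltn_ord b)) //.
by rewrite [in RHS]addrCA modzDl.
Qed.

Theorem theorem10 (G : sgraph) (Gconn : connected_graph G) (Gcubic : cubic G)
    (Gmcsd : admits_MCSD G) (GnK4 : ~ isomorphic G (complete_graph 4)) :
  has_6CDC G.
Proof.
have [G_gt0 _] := Gconn.
have [r r_bij] := Gmcsd; rewrite max_degree_cubic // => labels3.
(* The group structure lives on ['I_m.+1], so the order is written as a successor and [r] is
   cast. *)
case EG : #|G| => [|m]; first by rewrite EG in G_gt0.
pose f x := cast_ord EG (r x).
have f_bij : bijective f.
  apply: inj_card_bij; last by rewrite card_ord EG.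
  by move=> x y /cast_ord_inj/(bij_inj r_bij).
have labelE u v : chordal_label r u v = (f v - f u : 'I_m.+1)%R%:Z.
  by rewrite -modz_subE; congr modz; rewrite EG.
pose S := [set d | [exists u, exists v, adj u v && (f v - f u == d)]].
have adjS x y : adj x y -> f y - f x \in S.
  by move=> xy; rewrite inE; apply/existsP; exists x; apply/existsP; exists y;
    rewrite xy eqxx.
have S3 : #|S| = 3%N.
  rewrite -labels3 cardE -(size_map (fun d : 'I_m.+1 => d%:Z)).
  apply: perm_size; apply: uniq_perm; last 1 first.
  - move=> z; rewrite mem_undup; apply/mapP/imageP => [[d]|[[u v] /= uv ->]].
      rewrite mem_enum inE => /existsP[u /existsP[v /andP[uv /eqP <-]]] ->.
      by exists (u, v); rewrite ?labelE.
    by exists (f v - f u); rewrite ?labelE // mem_enum adjS.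
  - by rewrite map_inj_uniq ?enum_uniq // => x y [] /val_inj.
  exact: undup_uniq.
apply: (circulant_6CDC f_bij _ S3) => // x y.
apply/idP/idP => [|xyS]; first exact: adjS.
have sub_inj : injective (fun z => f z - f x).
  by move=> z z' /addIr /(bij_inj f_bij).
(* Minimality enters here: the neighbours of [x] give three distinct differences inside the
   three-element set [S], hence all of it. *)
have nbrsS : [set f z - f x | z in [set z | adj x z]] = S.
  apply/eqP; rewrite eqEcard card_imset // [#|[set z | _]|]Gcubic S3 andbT.
  by apply/subsetP => d /imsetP[z]; rewrite inE => xz ->; apply: adjS.
move: xyS; rewrite -nbrsS => /imsetP[z]; rewrite inE => xz /sub_inj ->.
exact: xz.
Qed.
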